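(* Let $\Phi$ be a Euclidean domain, let $0\neq z\in\Phi\setminus\Phi^*$, and let $A=\Phi\langle x_1,x_2\rangle$ be the free nonassociative algebra over $\Phi$ with free generators $x_1,x_2$. Then the automorphism $$\eta=\bigl(x_1+x_2(zx_1-x_2^2)+(zx_1-x_2^2)x_2+z(zx_1-x_2^2)^2,\; x_2+z(zx_1-x_2^2)\bigr)$$ of $A$ is wild.
   Context: A Euclidean domain here is a (commutative) integral domain $\Phi$ that is not a field, for which there is a function (norm) $|\cdot|:\Phi\setminus\{0\}\to\mathbb{Z}_+=\{0,1,2,\dots\}$ such that: (E1) for all $a,b\in\Phi\setminus\{0\}$, $|ab|\ge |a|$, with equality only when $b$ is invertible; (E2) for all $a,b\in\Phi$ with $b\ne 0$ there are $q,r\in\Phi$ with $a=bq+r$ and either $r=0$ or $|r|<|b|$. $\Phi^*$ denotes the set of invertible elements of $\Phi$. The algebra $A$ is the free (not necessarily associative, not necessarily commutative) $\Phi$-algebra on $x_1,x_2$; $u^2$ denotes $u\cdot u$. The notation $(f_1,f_2)$ denotes the $\Phi$-algebra endomorphism $\phi$ with $\phi(x_1)=f_1$, $\phi(x_2)=f_2$; the given $\eta$ is an automorphism of $A$. Elementary automorphisms of $A$ are those of the form $(\alpha x_1+f,\,x_2)$ with $\alpha\in\Phi^*$ and $f$ in the subalgebra generated by $x_2$, or $(x_1,\,\beta x_2+g)$ with $\beta\in\Phi^*$ and $g$ in the subalgebra generated by $x_1$. An automorphism is tame if it belongs to the subgroup of $\mathrm{Aut}(A)$ generated by all elementary automorphisms,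 and wild otherwise. *)

(* Defs.v *)
From HB Require Import structures.
From mathcomp Require Import all_boot all_algebra.
From mathcomp Require Import finmap.
From mathcomp Require Import monalg.

Set Implicit Arguments.
Unset Strict Implicit.
Unset Printing Implicit Defensive.

Import GRing.Theory.
Local Open Scope ring_scope.

(* The underlying ring is an idomainType: commutative, nonzero, without zero
   divisors.  The norm is defined on the nonzero elements only; here it is a
   total function whose value at 0 is never used. *)
Definition euclidean_norm (Phi : idomainType) (N : Phi -> nat) : Prop :=
  (forall a b : Phi, a != 0 -> b != 0 ->
     (N a <= N (a * b)%R)%N /\ (N (a * b) = N a -> b \is a GRing.unit)) /\
  (forall a b : Phi, b != 0 ->
     exists q r : Phi, a = b * q + r /\ (r = 0 \/ (N r < N b)%N)).

Definition euclidean_domain (Phi : idomainType) : Prop :=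
  (exists a : Phi, a != 0 /\ a \isn't a GRing.unit) /\
  (exists N : Phi -> nat, euclidean_norm N).

(* Nonempty nonassociative words in the letters x1, x2. *)
Inductive word : Type :=
| X1
| X2
| Mul of word & word.

Fixpoint word_encode (w : word) : GenTree.tree bool :=
  match w with
  | X1 => GenTree.Leaf true
  | X2 => GenTree.Leaf false
  | Mul v w => GenTree.Node 0 [:: word_encode v; word_encode w]
  end.

Fixpoint word_decode (t : GenTree.tree bool) : option word :=
  match t with
  | GenTree.Leaf b => Some (if b then X1 else X2)
  | GenTree.Node _ [:: t1; t2] =>
      if (word_decode t1, word_decode t2) is (Some v, Some w)
      then Some (Mul v w) else None
  | _ => None
  end.

Lemma word_encodeK : pcancel word_encode word_decode.
Proof. by elim=> //= v -> w ->. Qed.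

HB.instance Definition _ := Countable.copy word (pcan_type word_encodeK).

(* Free algebras without (u = false) and with (u = true) identity element are
   treated together:  'I_u is empty when u = false, and for u = true its single
   element is the empty word, i.e. the identity element. *)
Notation monom u := (word + 'I_(nat_of_bool u))%type.

Definition mmon (u : bool) (m n : monom u) : monom u :=
  match m, n with
  | inl v, inl w => inl (Mul v w)
  | inr _, _ => n
  | _, inr _ => m
  end.

Notation free_alg Phi u := {malg Phi[monom u]}.

Section FreeAlgebra.
Context (Phi : idomainType) (u : bool).
Local Notation A := (free_alg Phi u).

Definition mon (m : monom u) : A := << m >>.

Definition x1 : A := mon (inl X1).
Definition x2 : A := mon (inl X2).

Definition one_ (e : 'I_u) : A := mon (inr e).

Definition amul (a b : A) : A :=
  \sum_(m <- msupp a) \sum_(n <- msupp b) (a@_m * b@_n) *: mon (mmon m n).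

Definition is_endo (phi : A -> A) : Prop :=
  linear phi /\
  (forall a b, phi (amul a b) = amul (phi a) (phi b)) /\
  (forall e, phi (one_ e) = one_ e).

Definition is_auto (phi : A -> A) : Prop := is_endo phi /\ bijective phi.

Fixpoint word_eval (f1 f2 : A) (w : word) : A :=
  match w with
  | X1 => f1
  | X2 => f2
  | Mul v w => amul (word_eval f1 f2 v) (word_eval f1 f2 w)
  end.

Definition monom_eval (f1 f2 : A) (m : monom u) : A :=
  match m with
  | inl w => word_eval f1 f2 w
  | inr e => one_ e
  end.

(* The endomorphism written (f1, f2). *)
Definition endo (f1 f2 : A) (a : A) : A :=
  \sum_(m <- msupp a) a@_m *: monom_eval f1 f2 m.

(* The subalgebra generated by g. *)
Inductive subalg (g : A) : A -> Prop :=
| subalg_gen : subalg g g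
| subalg_one e : subalg g (one_ e)
| subalg_zero : subalg g 0
| subalg_add a b : subalg g a -> subalg g b -> subalg g (a + b)
| subalg_scale (c : Phi) a : subalg g a -> subalg g (c *: a)
| subalg_mul a b : subalg g a -> subalg g b -> subalg g (amul a b).

Definition elementary (phi : A -> A) : Prop :=
  is_auto phi /\
  ((exists (alpha : Phi) (f : A),
      [/\ alpha \is a GRing.unit, subalg x2 f &
          phi =1 endo (alpha *: x1 + f) x2]) \/
   (exists (beta : Phi) (g : A),
      [/\ beta \is a GRing.unit, subalg x1 g &
          phi =1 endo x1 (beta *: x2 + g)])).

(* The subgroup generated by the elementary automorphisms, automorphisms being
   identified when they agree pointwise. *)
Inductive tame : (A -> A) -> Prop :=
| tame_elementary phi : elementary phi -> tame phi
| tame_id : tame id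
| tame_comp phi psi : tame phi -> tame psi -> tame (phi \o psi)
| tame_inv phi psi :
    tame phi -> cancel phi psi -> cancel psi phi -> tame psi
| tame_ext phi psi : phi =1 psi -> tame phi -> tame psi.

Definition wild (phi : A -> A) : Prop := is_auto phi /\ ~ tame phi.

End FreeAlgebra.

Arguments x1 {Phi u}.
Arguments x2 {Phi u}.

Declare Scope free_alg_scope.
Delimit Scope free_alg_scope with A.
Notation "a ** b" := (amul a b) (at level 40, left associativity)
  : free_alg_scope.

(* Main.v *)
Require Import Defs.
From HB Require Import structures.
From mathcomp Require Import all_boot all_algebra finmap monalg.
From mathcomp Require Import ring zify.
Import GRing.Theory.
Local Open Scope ring_scope.
Local Open Scope free_alg_scope.

(** Put w = z x1 - x2^2.  The automorphism is the time-one map of a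
    one-parameter group fixing w (the additive group acts by
    x2 |-> x2 + t z w, and the image of x1 is forced by the invariance of w;
    see [flow_invariant], [flow1D]).  Hence it is invertible.

    Wildness rests on leading terms.  Composing an automorphism (f1, f2) on the
    right with elementary ones amounts to replacing f1 by k f1 + p with k a unit
    and p in the subalgebra generated by f2, or the same with f1 and f2
    exchanged.  The pairs reachable from (x1, x2) in this way all lie in the
    class [good], whose members other than affine pairs are affine images of a
    pair (h1 + p, h2) in which (h1, h2) is good, p is in the subalgebra
    generated by h2, and deg h1 <= deg h2 < deg p.  The class is closed under
    elementary moves ([good_shear]), and its point is [good_reduction]: if
    deg f2 < deg f1, then f1 = h + p with p in the subalgebra generated by f2
    and deg h <= deg f2.  In other words the leading part of f1 is an expression
    in f2 with coefficients in the ground ring.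

    A free nonassociative algebra has no relations among leading parts: if t is
    a word of maximal size in g, with coefficient c, then the one-variable word
    w of length n, evaluated at g, has coefficient c^n at the word obtained by
    grafting t on the leaves of w, and no other one-variable word of length at
    most n contributes there ([word_eval_graft]).  So an element of degree at
    most d deg g in the subalgebra generated by g is a combination of words of
    length at most d in g ([subalg_low_ind]).

    For the automorphism at hand deg f1 = 4 and deg f2 = 2, so, if it were tame,
    f1 would be c f2^2 plus terms of degree at most 2.  At the word
    (x2 x2)(x2 x2) the coefficient of f1 is z while that of f2^2 is z^2; thus
    c z = 1, and z would be a unit. *)

(** * Identities in a module *)

Section Module.
Context {Phi : idomainType} {V : lmodType Phi}.
Implicit Types (x y p q k r : V) (d s t z : Phi).

(** In the three flow identities p, q, r stand for the products x2 w, w x2, w w,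
    and k for the sum of the first two. *)
Lemma flow_square y p q r d :
  y + d *: p + (d *: q + d *: (d *: r)) = y + d *: (p + q) + (d * d) *: r.
Proof. by rewrite !scalerDr scalerA !addrA. Qed.

Lemma flow_cancel x y k r t z :
  z *: (x + t *: k + (t * t * z) *: r)
  - (y + (t * z) *: k + (t * z * (t * z)) *: r) = z *: x - y.
Proof.
rewrite !scalerDr !scalerA !opprD addrACA [z *: x + _ + _]addrACA.
by rewrite (mulrC z t) (_ : z * _ = t * z * (t * z)) ?subrr ?addr0 //; ring.
Qed.

Lemma flow_sum x p q r s t z :
  x + s *: (p + q) + (s * s * z) *: r
  + t *: ((p + (s * z) *: r) + (q + (s * z) *: r)) + (t * t * z) *: r
  = x + (s + t) *: (p + q) + ((s + t) * (s + t) * z) *: r.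
Proof.
rewrite [p + _ + _]addrACA -scalerDl; move: (p + q) => k.
rewrite scalerDr scalerA addrACA -!addrA; congr (x + _).
rewrite !addrA -scalerDl -!addrA -!scalerDl.
by congr (_ + _ *: _); ring.
Qed.

Lemma lincomb2 (k0 k1 l1 k2 l2 : Phi) x y r q :
  k0 *: (k1 *: x + (l1 *: y + r)) + (k2 *: x + (l2 *: y + q))
  = (k0 * k1 + k2) *: x + ((k0 * l1 + l2) *: y + (k0 *: r + q)).
Proof.
by rewrite !scalerDr addrACA (addrACA (k0 *: (l1 *: y))) !scalerA !scalerDl.
Qed.

Lemma lincomb_comp (a b a' b' c' d' : Phi) x y p q r :
  a *: (a' *: x + (b' *: y + p)) + (b *: (c' *: x + (d' *: y + q)) + r)
  = (a * a' + b * c') *: x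
    + ((a * b' + b * d') *: y + (a *: p + (b *: q + r))).
Proof.
rewrite !scalerDr !scalerA !scalerDl -!addrA; congr (_ + _).
move: (_ *: p) => p'; rewrite [p' + _]addrCA [LHS]addrCA.
by do 2 congr (_ + _); apply: addrCA.
Qed.

End Module.

Section Algebra.
Context {Phi : idomainType} {u : bool}.
Local Notation A := (free_alg Phi u).
Local Notation mon := (@mon Phi u).
Implicit Types (a b c f g p : A) (m n : monom u) (v w : word).

(** * Linear and bilinear extension *)

Definition lin_ext (F : monom u -> A) (a : A) : A :=
  \sum_(m <- msupp a) a@_m *: F m.

Lemma lin_extEw F a (d : {fset monom u}) : (msupp a `<=` d)%fset ->
  lin_ext F a = \sum_(m <- d) a@_m *: F m.
Proof.
move=> le_ad; rewrite /lin_ext; apply: big_fset_incl => // m _.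
by move/mcoeff_outdom ->; rewrite scale0r.
Qed.

Lemma lin_ext_linear F : linear (lin_ext F).
Proof.
move=> k a b.
pose d := (msupp a `|` msupp b `|` msupp (k *: a + b))%fset.
rewrite (@lin_extEw F a d); last by rewrite /d -fsetUA fsubsetUl.
rewrite (@lin_extEw F b d); last by rewrite /d fsetUAC fsubsetUr.
rewrite (@lin_extEw F (k *: a + b) d); last by rewrite /d fsubsetUr.
rewrite scaler_sumr -big_split /=; apply: eq_bigr => m _.
by rewrite mcoeffD mcoeffZ scalerDl scalerA.
Qed.

HB.instance Definition _ F :=
  GRing.isLinear.Build Phi A A _ (lin_ext F) (lin_ext_linear F).

Lemma lin_ext_mon F m : lin_ext F (mon m) = F m.
Proof.
rewrite /lin_ext /Defs.mon msuppU oner_eq0 big_seq_fset1.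
by rewrite mcoeffUU scale1r.
Qed.

Lemma mcoeff_mon m n : (mon m)@_n = (m == n)%:R.
Proof. by rewrite /Defs.mon mcoeffU. Qed.

Lemma lin_extE F a : lin_ext F a = \sum_(m <- msupp a) a@_m *: F m.
Proof. by []. Qed.

Lemma malg_monE a : a = lin_ext mon a.
Proof.
rewrite [LHS]monalgE; apply: eq_bigr => m _.
by apply/malgP => n; rewrite mcoeffZ !mcoeffU mulr_natr.
Qed.

(** Multilinear identities are proved by this induction, one argument at a
    time. *)
Lemma mon_ind (P : A -> Prop) :
  P 0 -> (forall k a b, P a -> P b -> P (k *: a + b)) ->
  (forall m, P (mon m)) -> forall a, P a.
Proof.
move=> P0 Plin Pmon a; rewrite (malg_monE a) /lin_ext.
by elim/big_rec: _ => // m b _ Pb; apply: Plin.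
Qed.

Lemma endoE f1 f2 : endo f1 f2 = lin_ext (monom_eval f1 f2).
Proof. by []. Qed.

Lemma amulE a b :
  amul a b = lin_ext (fun m => lin_ext (fun n => mon (mmon m n)) b) a.
Proof.
apply: eq_bigr => m _; rewrite scaler_sumr.
by apply: eq_bigr => n _; rewrite scalerA.
Qed.

Lemma amul_monM m n : mon m ** mon n = mon (mmon m n).
Proof. by rewrite amulE !lin_ext_mon. Qed.

Lemma amulDZl k a b c : (k *: a + b) ** c = k *: (a ** c) + b ** c.
Proof. by rewrite !amulE linearP. Qed.

Lemma amulDZr k a b c : c ** (k *: a + b) = k *: (c ** a) + c ** b.
Proof.
rewrite !amulE !lin_extE scaler_sumr -big_split; apply: eq_bigr => m _ /=.
by rewrite linearP /= scalerDr !scalerA mulrC.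
Qed.

Lemma amul0l c : 0 ** c = 0. Proof. by rewrite amulE linear0. Qed.

Lemma amul0r c : c ** 0 = 0.
Proof. by have := amulDZr (-1) 0 0 c; rewrite scaler0 addr0 scaleN1r addNr. Qed.

Lemma amulDl a b c : (a + b) ** c = a ** c + b ** c.
Proof. by have := amulDZl 1 a b c; rewrite !scale1r. Qed.

Lemma amulDr a b c : c ** (a + b) = c ** a + c ** b.
Proof. by have := amulDZr 1 a b c; rewrite !scale1r. Qed.

Lemma amulZl k a c : (k *: a) ** c = k *: (a ** c).
Proof. by have := amulDZl k a 0 c; rewrite amul0l !addr0. Qed.

Lemma amulZr k a c : c ** (k *: a) = k *: (c ** a).
Proof. by have := amulDZr k a 0 c; rewrite amul0r !addr0. Qed.

(** * Endomorphisms *)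

Lemma endo_x1 f1 f2 : endo f1 f2 x1 = f1.
Proof. by rewrite endoE lin_ext_mon. Qed.

Lemma endo_x2 f1 f2 : endo f1 f2 x2 = f2.
Proof. by rewrite endoE lin_ext_mon. Qed.

Lemma endo_congr (f1 f2 g1 g2 : A) :
  f1 = g1 -> f2 = g2 -> endo f1 f2 = endo g1 g2.
Proof. by move=> -> ->. Qed.

Lemma one_amul (e : 'I_u) a : one_ Phi e ** a = a.
Proof. by rewrite amulE lin_ext_mon /= -malg_monE. Qed.

Lemma unit_word_eq (e e' : 'I_u) : e = e'.
Proof.
apply: ord_inj; case: e e' => [i +] [j +] /=.
by case: (u) => //=; case: i j => [|i] [|j].
Qed.

Lemma amul_one (e : 'I_u) a : a ** one_ Phi e = a.
Proof.
rewrite amulE [RHS]malg_monE; apply: eq_bigr => m _; rewrite lin_ext_mon.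
by case: m => [w|e']; [|rewrite (unit_word_eq e' e)].
Qed.

Lemma endo_is_endo f1 f2 : is_endo (endo f1 f2).
Proof.
rewrite endoE; split; first exact: lin_ext_linear.
split; last by move=> e; rewrite lin_ext_mon.
move=> a b; elim/mon_ind: a => [|k a1 a2 IH1 IH2|m].
- by rewrite amul0l !linear0 amul0l.
- by rewrite amulDZl lin_ext_linear IH1 IH2 lin_ext_linear amulDZl.
elim/mon_ind: b => [|k b1 b2 IH1 IH2|n].
- by rewrite amul0r !linear0 amul0r.
- by rewrite amulDZr lin_ext_linear IH1 IH2 lin_ext_linear amulDZr.
rewrite amul_monM !lin_ext_mon.
by case: m n => [v|e] [w|e'] //=; rewrite ?one_amul ?amul_one.
Qed.

Section EndoTheory.
Context {phi : A -> A} (phiP : is_endo phi).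

Lemma endoDZ k a b : phi (k *: a + b) = k *: phi a + phi b.
Proof. by case: phiP => + _; apply. Qed.

Lemma endoM a b : phi (a ** b) = phi a ** phi b.
Proof. by case: phiP => _ [+ _]; apply. Qed.

Lemma endo_one e : phi (one_ Phi e) = one_ Phi e.
Proof. by case: phiP => _ [_]; apply. Qed.

Lemma endo0 : phi 0 = 0.
Proof. by have := endoDZ (-1) 0 0; rewrite scaler0 addr0 scaleN1r addNr. Qed.

Lemma endoD a b : phi (a + b) = phi a + phi b.
Proof. by have := endoDZ 1 a b; rewrite !scale1r. Qed.

Lemma endoZ k a : phi (k *: a) = k *: phi a.
Proof. by have := endoDZ k a 0; rewrite endo0 !addr0. Qed.

Lemma endoB a b : phi (a - b) = phi a - phi b.
Proof. by rewrite -(scaleN1r b) endoD endoZ scaleN1r. Qed.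

Lemma endo_subalg g p : subalg g p -> subalg (phi g) (phi p).
Proof.
elim=> [|e||a b _ IHa _ IHb|k a _ IHa|a b _ IHa _ IHb].
- exact: subalg_gen.
- by rewrite endo_one; apply: subalg_one.
- by rewrite endo0; apply: subalg_zero.
- by rewrite endoD; apply: subalg_add.
- by rewrite endoZ; apply: subalg_scale.
- by rewrite endoM; apply: subalg_mul.
Qed.

Lemma endo_unique : phi =1 endo (phi x1) (phi x2).
Proof.
have gP := endo_is_endo (phi x1) (phi x2).
move=> a; elim/mon_ind: a => [|k a b IHa IHb|m].
- by rewrite endo0 endoE linear0.
- by rewrite endoDZ IHa IHb !endoE linearP.
rewrite endoE lin_ext_mon; case: m => [w|e] /=; last exact: endo_one.
elim: w => //= v <- w <-; rewrite -endoM; congr phi.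
by rewrite amul_monM.
Qed.

End EndoTheory.

Lemma comp_is_endo {phi psi : A -> A} :
  is_endo phi -> is_endo psi -> is_endo (phi \o psi).
Proof.
move=> phiP psiP; split=> [k a b|] /=.
  by rewrite (endoDZ psiP) (endoDZ phiP).
split=> [a b|e] /=; first by rewrite (endoM psiP) (endoM phiP).
by rewrite (endo_one psiP) (endo_one phiP).
Qed.

Lemma id_is_endo : is_endo (@id A).
Proof. by []. Qed.

Lemma inverse_is_endo {phi psi : A -> A} :
  is_endo phi -> cancel phi psi -> cancel psi phi -> is_endo psi.
Proof.
move=> phiP phiK psiK; split=> [k a b|].
  by apply: (can_inj phiK); rewrite (endoDZ phiP) !psiK.
by split=> [a b|e]; apply: (can_inj phiK);
  rewrite ?(endoM phiP) ?(endo_one phiP) !psiK.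
Qed.

(** * The one-parameter group *)

Section OneParameter.
Context (z : Phi).

(** The generators at time [t] of the flow with x2' = z w and
    x1' = x2 w + w x2, along which w is constant: differentiating
    w = z x1 - x2^2 gives z x1' - x2' x2 - x2 x2' = 0. *)
Definition flow1 (X Y w : A) (t : Phi) : A :=
  X + t *: (Y ** w + w ** Y) + (t * t * z) *: (w ** w).

Definition flow2 (Y w : A) (t : Phi) : A := Y + (t * z) *: w.

Lemma flow_invariant (X Y w : A) t : z *: X - Y ** Y = w ->
  z *: flow1 X Y w t - flow2 Y w t ** flow2 Y w t = w.
Proof.
move=> wE; rewrite /flow1 /flow2 amulDl !amulDr !amulZl !amulZr.
apply: etrans (etrans (flow_cancel _ _ (Y ** w + w ** Y) (w ** w) t z) wE).
by congr (_ - _); apply: flow_square.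
Qed.

Lemma flow1D (X Y w : A) s t :
  flow1 (flow1 X Y w s) (flow2 Y w s) w t = flow1 X Y w (s + t).
Proof.
by rewrite /flow1 /flow2 amulDl amulDr amulZl amulZr; apply: flow_sum.
Qed.

Lemma flow2D (Y w : A) s t : flow2 (flow2 Y w s) w t = flow2 Y w (s + t).
Proof. by rewrite /flow2 -addrA -scalerDl -mulrDl. Qed.

Lemma flow1_0 (X Y w : A) : flow1 X Y w 0 = X.
Proof. by rewrite /flow1 !mul0r !scale0r !addr0. Qed.

Lemma flow2_0 (Y w : A) : flow2 Y w 0 = Y.
Proof. by rewrite /flow2 mul0r scale0r addr0. Qed.

Lemma flow1_1 (X Y w : A) :
  flow1 X Y w 1 = X + Y ** w + w ** Y + z *: (w ** w).
Proof. by rewrite /flow1 !mul1r scale1r addrA. Qed.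

Lemma flow2_1 (Y w : A) : flow2 Y w 1 = Y + z *: w.
Proof. by rewrite /flow2 mul1r. Qed.

Section FlowEndo.
Context {phi : A -> A} {X Y w : A} {s : Phi}.
Context (phiP : is_endo phi) (wE : z *: X - Y ** Y = w).
Context (phiX : phi X = flow1 X Y w s) (phiY : phi Y = flow2 Y w s).

(** An endomorphism moving [X] and [Y] to their values at time [s] fixes [w],
    hence shifts the whole flow by [s]. *)
Lemma endo_flow_w : phi w = w.
Proof.
rewrite -[in LHS]wE (endoB phiP) (endoZ phiP) (endoM phiP) phiX phiY.
exact: flow_invariant.
Qed.

Lemma endo_flow1 t : phi (flow1 X Y w t) = flow1 X Y w (s + t).
Proof.
rewrite !(endoD phiP, endoZ phiP, endoM phiP) endo_flow_w phiX phiY.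
exact: flow1D.
Qed.

Lemma endo_flow2 t : phi (flow2 Y w t) = flow2 Y w (s + t).
Proof.
by rewrite (endoD phiP) (endoZ phiP) endo_flow_w phiY; apply: flow2D.
Qed.

End FlowEndo.

Definition eta_w : A := z *: x1 - x2 ** x2.

Definition eta_flow (t : Phi) : A -> A :=
  endo (flow1 x1 x2 eta_w t) (flow2 x2 eta_w t).

Lemma eta_flow1 :
  endo (x1 + x2 ** eta_w + eta_w ** x2 + z *: (eta_w ** eta_w))
    (x2 + z *: eta_w) = eta_flow 1.
Proof.
rewrite /eta_flow; apply: endo_congr; first exact: esym (flow1_1 x1 x2 eta_w).
exact: esym (flow2_1 x2 eta_w).
Qed.

Lemma eta_flow_endo t : is_endo (eta_flow t).
Proof. exact: endo_is_endo. Qed.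

Lemma eta_flow_comp s t : eta_flow s \o eta_flow t =1 eta_flow (s + t).
Proof.
have fP := eta_flow_endo s.
have s1 := endo_x1 (flow1 x1 x2 eta_w s) (flow2 x2 eta_w s).
have s2 := endo_x2 (flow1 x1 x2 eta_w s) (flow2 x2 eta_w s).
move=> a; apply: etrans (endo_unique (comp_is_endo fP (eta_flow_endo t)) a) _.
congr (endo _ _ _).
  apply: etrans (endo_flow1 fP (erefl _) s1 s2 t).
  exact: congr1 (endo_x1 _ _).
apply: etrans (endo_flow2 fP (erefl _) s1 s2 t).
exact: congr1 (endo_x2 _ _).
Qed.

Lemma eta_flow0 : eta_flow 0 =1 id.
Proof.
move=> a; apply: etrans (esym (endo_unique id_is_endo a)).
by congr (endo _ _ _); [apply: flow1_0|apply: flow2_0].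
Qed.

Lemma eta_flow_auto t : is_auto (eta_flow t).
Proof.
split; first exact: endo_is_endo.
exists (eta_flow (- t)) => a.
  rewrite -[LHS]/((eta_flow (- t) \o eta_flow t) a).
  by rewrite eta_flow_comp addNr eta_flow0.
rewrite -[LHS]/((eta_flow t \o eta_flow (- t)) a).
by rewrite eta_flow_comp addrN eta_flow0.
Qed.

End OneParameter.
End Algebra.

(** * Degree *)

Fixpoint wsize (w : word) : nat :=
  if w is Mul v w' then (wsize v + wsize w')%N else 1.

Definition msize {u : bool} (m : monom u) : nat :=
  if m is inl w then wsize w else 0.

Lemma wsize_gt0 w : (0 < wsize w)%N.
Proof. by elim: w => //= v v_gt0 w _; rewrite addn_gt0 v_gt0. Qed.

Section Degree.
Context {Phi : idomainType} {u : bool}.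
Local Notation A := (free_alg Phi u).
Local Notation mon := (@mon Phi u).
Implicit Types (a b c e f g h p q : A) (m : monom u) (n : nat).
Implicit Types (v w : word) (k : Phi).

(** The coefficient of the identity, read as 0 when there is no identity;
    summing over ['I_u] covers both cases at once. *)
Definition const_coef a : Phi := \sum_(i : 'I_u) a@_(inr i).

Lemma const_coef_linear k a b :
  const_coef (k *: a + b) = k * const_coef a + const_coef b.
Proof.
rewrite /const_coef mulr_sumr -big_split; apply: eq_bigr => i _ /=.
by rewrite mcoeffD mcoeffZ.
Qed.

Lemma const_coef_mon m : const_coef (mon m) = if m is inl _ then 0 else 1.
Proof.
case: m => [w|i]; first by apply: big1 => i _; rewrite mcoeff_mon.
rewrite /const_coef (bigD1 i) //= mcoeff_mon eqxx big1 ?addr0 // => j.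
by rewrite (unit_word_eq j i) eqxx.
Qed.

Lemma const_coef0 : const_coef 0 = 0.
Proof. by apply: big1 => i _; rewrite mcoeff0. Qed.

Definition split_coef a b w : Phi :=
  if w is Mul v v' then a@_(inl v) * b@_(inl v') else 0.

Lemma split_coefDZl k a1 a2 b w :
  split_coef (k *: a1 + a2) b w = k * split_coef a1 b w + split_coef a2 b w.
Proof.
case: w => [||v v'] /=; try by rewrite mulr0 addr0.
by rewrite mcoeffD mcoeffZ mulrDl mulrA.
Qed.

Lemma split_coefDZr k a b1 b2 w :
  split_coef a (k *: b1 + b2) w = k * split_coef a b1 w + split_coef a b2 w.
Proof.
case: w => [||v v'] /=; try by rewrite mulr0 addr0.
by rewrite mcoeffD mcoeffZ mulrDr mulrCA.
Qed.

Lemma split_coef0l b w : split_coef 0 b w = 0.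
Proof. by case: w => [||v v'] //=; rewrite mcoeff0 mul0r. Qed.

Lemma split_coef0r a w : split_coef a 0 w = 0.
Proof. by case: w => [||v v'] //=; rewrite mcoeff0 mulr0. Qed.

(** A word has at most one factorization into two nonempty words, so besides
    the terms coming from the identity a product contributes to the coefficient
    at a word through a single product of coefficients. *)
Lemma mcoeff_amul a b w :
  (a ** b)@_(inl w) = const_coef a * b@_(inl w) + a@_(inl w) * const_coef b
    + split_coef a b w.
Proof.
elim/(@mon_ind Phi u): a => [|k a1 a2 IH1 IH2|m].
- by rewrite amul0l const_coef0 split_coef0l !mcoeff0 !mul0r !addr0.
- rewrite amulDZl const_coef_linear split_coefDZl !mcoeffD !mcoeffZ IH1 IH2.
  by move: (a1@_ _) (a2@_ _) (b@_ _)
    (split_coef _ _ _) (split_coef _ _ _) => *; ring.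
elim/(@mon_ind Phi u): b => [|k b1 b2 IH1 IH2|n].
- by rewrite amul0r const_coef0 split_coef0r !mcoeff0 !mulr0 !addr0.
- rewrite amulDZr const_coef_linear split_coefDZr !mcoeffD !mcoeffZ IH1 IH2.
  by move: (b1@_ _) (b2@_ _) ((mon m)@_ _)
    (split_coef _ _ _) (split_coef _ _ _) => *; ring.
rewrite amul_monM !const_coef_mon !mcoeff_mon.
have splitE : split_coef (mon m) (mon n) w =
    if w is Mul v v' then (m == inl v)%:R * (n == inl v')%:R else 0.
  by case: w => // v v'; rewrite /split_coef !mcoeff_mon.
rewrite {}splitE; case: m n => [v|i] [v'|j]; case: w => [||w w'];
  rewrite ?(mulr0, mul0r, mulr1, mul1r, add0r, addr0) //.
rewrite -natrM mulnb; congr (nat_of_bool _)%:R.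
by apply/eqP/andP => [[<- <-]|[/eqP[<-] /eqP[<-]]].
Qed.

(** The degree of 0 is 0, so [deg e = 0] says that [e] is a constant: a multiple
    of the identity if there is one, and 0 otherwise. *)
Definition deg a : nat := \max_(m <- msupp a) msize m.

Lemma degP a n : (deg a <= n)%N <-> forall w, (n < wsize w)%N -> a@_(inl w) = 0.
Proof.
split=> [a_le w w_gt|a0].
  apply: mcoeff_outdom; apply: contraL w_gt => w_in; rewrite -leqNgt.
  apply: leq_trans a_le.
  by rewrite -[wsize w]/(msize (inl w : monom u)); apply: leq_bigmax_seq.
apply/bigmax_leqP_seq => -[w|i] //= w_in _; rewrite leqNgt.
by apply: contraL w_in => /a0/eqP; rewrite mcoeff_eq0.
Qed.

Lemma coef_gt_deg a w : (deg a < wsize w)%N -> a@_(inl w) = 0.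
Proof. by move=> w_gt; apply: (proj1 (degP a (deg a)) (leqnn _)). Qed.

Lemma coef_neq0_deg a w : a@_(inl w) != 0 -> (wsize w <= deg a)%N.
Proof. by apply: contraR; rewrite -ltnNge => /coef_gt_deg ->. Qed.

Lemma deg_coef a :
  (0 < deg a)%N -> exists2 w, wsize w = deg a & a@_(inl w) != 0.
Proof.
move=> a_gt0.
have : has (fun m => msize m == deg a) (msupp a).
  apply/contraT => /hasPn no; suff : (deg a <= (deg a).-1)%N by lia.
  apply/bigmax_leqP_seq => m m_in _.
  have := no m m_in; have : (msize m <= deg a)%N by apply: leq_bigmax_seq.
  by lia.
case/hasP=> -[w|i] /=; last by move=> _ /eqP d0; rewrite -d0 in a_gt0.
by rewrite -mcoeff_neq0 => aw /eqP dE; exists w.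
Qed.

Lemma deg_linear k a b n :
  (deg a <= n)%N -> (deg b <= n)%N -> (deg (k *: a + b)%R <= n)%N.
Proof.
move=> /degP a0 /degP b0; apply/degP => w w_gt.
by rewrite mcoeffD mcoeffZ a0 // b0 // mulr0 addr0.
Qed.

Lemma deg0 : deg 0 = 0%N.
Proof. by apply/eqP; rewrite -leqn0; apply/degP => w _; rewrite mcoeff0. Qed.

Lemma degZ k a n : (deg a <= n)%N -> (deg (k *: a) <= n)%N.
Proof. by move=> a_le; rewrite -[k *: a]addr0 deg_linear ?deg0. Qed.

Lemma degD a b n : (deg a <= n)%N -> (deg b <= n)%N -> (deg (a + b)%R <= n)%N.
Proof. by move=> a_le b_le; rewrite -[a]scale1r deg_linear. Qed.

Lemma degB a b n : (deg a <= n)%N -> (deg b <= n)%N -> (deg (a - b)%R <= n)%N.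
Proof. by move=> a_le b_le; rewrite addrC -scaleN1r deg_linear. Qed.

Lemma deg_one i : deg (one_ Phi i) = 0%N.
Proof. by apply/eqP; rewrite -leqn0; apply/degP => w _; rewrite mcoeff_mon. Qed.

Lemma degM a b : (deg (a ** b) <= deg a + deg b)%N.
Proof.
apply/degP => w w_gt; rewrite mcoeff_amul.
rewrite (coef_gt_deg b w) 1?(coef_gt_deg a w); try lia.
rewrite mulr0 mul0r !add0r; case: w w_gt => //= v v' vv'_gt.
have [v_gt|v_le] := ltnP (deg a) (wsize v).
  by rewrite (coef_gt_deg _ _ v_gt) mul0r.
by rewrite (coef_gt_deg b v') ?mulr0 //; lia.
Qed.

(** Words have positive size, so an element of degree 0 is supported on the
    identity. *)
Lemma subalg_const g e : deg e = 0%N -> subalg g e.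
Proof.
move=> e0; rewrite (malg_monE e) /lin_ext big_seq.
elim/big_rec: _ => [|m p m_in p_in]; first exact: subalg_zero.
apply: subalg_add => //; apply: subalg_scale.
case: m m_in => [w|i]; last by move=> _; apply: subalg_one.
by rewrite -mcoeff_neq0 coef_gt_deg ?eqxx // e0 wsize_gt0.
Qed.

Lemma deg_const_linear k e f :
  deg e = 0%N -> deg f = 0%N -> deg (k *: e + f) = 0%N.
Proof. by move=> e0 f0; apply/eqP; rewrite -leqn0 deg_linear ?e0 ?f0. Qed.

End Degree.

(** * One-variable subalgebras *)

(** One-variable words are the words in [X1] alone.  Evaluation sends [X1] to
    the generator of a one-variable subalgebra and [X2] to 0, which kills all
    other words. *)
Fixpoint pure (w : word) : bool :=
  match w with X1 => true | X2 => false | Mul v w' => pure v && pure w' end.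

Fixpoint graft (t w : word) : word :=
  match w with X1 => t | X2 => X2 | Mul v w' => Mul (graft t v) (graft t w') end.

Lemma wsize_graft t w : pure w -> wsize (graft t w) = (wsize w * wsize t)%N.
Proof. by elim: w => //= [|v IHv w IHw /andP[/IHv-> /IHw->]]; lia. Qed.

Lemma pure_wsize1 w : pure w -> (wsize w <= 1)%N -> w = X1.
Proof.
case: w => [||v w] //= _ w_le.
by have := wsize_gt0 v; have := wsize_gt0 w; lia.
Qed.

Section OneVariable.
Context {Phi : idomainType} {u : bool}.
Local Notation A := (free_alg Phi u).
Implicit Types (a b c e f g h p q : A) (m : monom u) (v w t : word) (k : Phi).

Lemma word_eval_impure g w : ~~ pure w -> word_eval g 0 w = 0.
Proof.
elim: w => //= v IHv w IHw; rewrite negb_and => /orP[/IHv->|/IHw->].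
  exact: amul0l.
exact: amul0r.
Qed.

Lemma deg_word_eval g w : (deg (word_eval g 0 w) <= wsize w * deg g)%N.
Proof.
elim: w => [||v IHv w IHw] /=; rewrite ?mul1n ?deg0 //.
by apply: leq_trans (degM _ _) _; rewrite mulnDl leq_add.
Qed.

Lemma word_eval_graft_lt g t w w' : wsize t = deg g -> (0 < deg g)%N ->
  pure w -> (wsize w' < wsize w)%N ->
  (word_eval g 0 w')@_(inl (graft t w)) = 0.
Proof.
move=> tE g_gt0 w_pure lt_w; apply: coef_gt_deg.
apply: leq_ltn_trans (deg_word_eval _ _) _.
by rewrite wsize_graft // tE ltn_pmul2r.
Qed.

(** If [t] is a leading word of [g], then [graft t w] is a leading word of the
    value of [w] at [g].  A product of values has, in top degree, coefficients
    which factor along the unique factorization of the word; matching sizes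
    factor by factor shows that no other word as short as [w] reaches
    [graft t w]. *)
Lemma word_eval_graft g t w w' : wsize t = deg g -> (0 < deg g)%N ->
  pure w -> (wsize w' <= wsize w)%N ->
  (word_eval g 0 w')@_(inl (graft t w))
    = if w' == w then g@_(inl t) ^+ wsize w else 0.
Proof.
move=> tE g_gt0; elim: w w' => [||v1 IHv1 v2 IHv2] w' //=.
  case: w' => [||w1 w2] //= _; rewrite ?mcoeff0 //.
  by have := wsize_gt0 w1; have := wsize_gt0 w2; lia.
move=> /andP[v1_pure v2_pure]; have v12_pure : pure (Mul v1 v2) by apply/andP.
rewrite leq_eqVlt => /orP[/eqP w'E|w'_lt]; last first.
  rewrite (word_eval_graft_lt g t (Mul v1 v2)) //.
  by case: eqP w'_lt => // ->; rewrite ltnn.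
case: w' w'E => [||w1 w2] /= w'E;
  try by have := wsize_gt0 v1; have := wsize_gt0 v2; lia.
have [w1_gt0 w2_gt0] := (wsize_gt0 w1, wsize_gt0 w2).
rewrite mcoeff_amul.
rewrite (word_eval_graft_lt g t (Mul v1 v2) w1) /=; [|by []..|lia].
rewrite (word_eval_graft_lt g t (Mul v1 v2) w2) /=; [|by []..|lia].
rewrite mulr0 mul0r !add0r.
have eqE : (Mul w1 w2 == Mul v1 v2) = (w1 == v1) && (w2 == v2).
  by apply/eqP/andP => [[-> ->]|[/eqP-> /eqP->]].
rewrite {}eqE exprD; case: (ltngtP (wsize w1) (wsize v1)) => w1E.
- rewrite (word_eval_graft_lt g t v1 w1) // mul0r.
  by case: eqP w1E => // ->; rewrite ltnn.
- rewrite (word_eval_graft_lt g t v2 w2) ?mulr0 //; last lia.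
  by case: eqP w1E => // ->; rewrite ltnn.
rewrite IHv1 ?w1E // IHv2 //; last lia.
by case: eqP => _; case: eqP => _; rewrite ?mulr0 ?mul0r.
Qed.

Lemma subalg_endo g p : subalg g p -> exists q, p = endo g 0 q.
Proof.
have gP := endo_is_endo g 0.
elim=> [|e||a b _ [qa ->] _ [qb ->]|k a _ [qa ->]|a b _ [qa ->] _ [qb ->]].
- by exists x1; rewrite endo_x1.
- by exists (one_ Phi e); rewrite (endo_one gP).
- by exists 0; rewrite (endo0 gP).
- by exists (qa + qb); rewrite (endoD gP).
- by exists (k *: qa); rewrite (endoZ gP).
- by exists (qa ** qb); rewrite (endoM gP).
Qed.

Lemma mcoeff_sum (s : seq (monom u)) (F : monom u -> A) (n : monom u) :
  (\sum_(m <- s) F m)@_n = \sum_(m <- s) (F m)@_n.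
Proof. by elim/big_rec2: _ => [|m x y _ <-]; rewrite ?mcoeff0 ?mcoeffD. Qed.

(** There is no cancellation among the longest words: the coefficient at
    [graft t w] isolates that of [w], provided longer words are absent.  Hence
    the descending induction on length. *)
Lemma endo_low g q (d : nat) :
  (0 < deg g)%N -> (deg (endo g 0 q) <= d * deg g)%N ->
  forall w, pure w -> (d < wsize w)%N -> q@_(inl w) = 0.
Proof.
move=> g_gt0 low; have [t tE gt_neq0] := deg_coef g g_gt0.
suff down (n : nat) :
    (forall w, pure w -> (d + n < wsize w)%N -> q@_(inl w) = 0) ->
    forall w, pure w -> (d < wsize w)%N -> q@_(inl w) = 0.
  by apply: (down (deg q)) => w _ w_gt; apply: coef_gt_deg; lia.
elim: n => [|n IHn] hi w w_pure w_gt; first by apply: hi; rewrite ?addn0.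
apply: IHn w w_pure w_gt => w w_pure w_ge.
have [w_gt|w_le] := ltnP (d + n.+1) (wsize w); first exact: hi.
have := coef_gt_deg (endo g 0 q) (graft t w).
rewrite wsize_graft // tE => /(_ _)/[dup] /=.
have lt_w : (deg (endo g 0 q) < wsize w * deg g)%N.
  by apply: leq_ltn_trans low _; rewrite ltn_pmul2r //; lia.
move=> /(_ lt_w) + _; rewrite /endo mcoeff_sum.
have [w_in|w_notin _] := boolP ((inl w : monom u) \in msupp q);
  last exact: mcoeff_outdom.
rewrite (bigD1_seq (inl w)) ?fset_uniq //= big1_seq ?addr0.
  rewrite mcoeffZ word_eval_graft // eqxx => /eqP.
  by rewrite mulf_eq0 expf_eq0 (negPf gt_neq0) andbF orbF => /eqP.
move=> -[w'|i] /andP[w'_neq _]; rewrite mcoeffZ /=; last first.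
  by rewrite mcoeff_mon mulr0.
have [w'_pure|/word_eval_impure->] := boolP (pure w');
  last by rewrite mcoeff0 mulr0.
have [w'_gt|w'_le] := ltnP (d + n.+1) (wsize w'); first by rewrite hi // mul0r.
rewrite word_eval_graft //; last lia.
have /negPf-> : w' != w by apply: contraNneq w'_neq => ->.
exact: mulr0.
Qed.

(** Since longer words do not occur, such an element is a linear combination of
    the constants and of the words of length at most [d] in [g]. *)
Lemma subalg_low_ind g (d : nat) (M : A -> Prop) :
  M 0 -> (forall k a b, M a -> M b -> M (k *: a + b)) ->
  (forall i, M (one_ Phi i)) ->
  (forall w, pure w -> (wsize w <= d)%N -> M (word_eval g 0 w)) ->
  (0 < deg g)%N ->
  forall p, subalg g p -> (deg p <= d * deg g)%N -> M p.
Proof.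
move=> M0 Mlin Mone Mword g_gt0 p /subalg_endo[q ->] low.
rewrite /endo big_seq; elim/big_rec: _ => // -[w|i] p' m_in Mp';
  apply: Mlin Mp' => /=; last exact: Mone.
have [w_pure|/word_eval_impure->//] := boolP (pure w).
apply: Mword => //; rewrite leqNgt; apply: contraL m_in => w_gt.
by rewrite -mcoeff_neq0 (endo_low g q d) ?eqxx.
Qed.

Lemma subalg_linear g p : subalg g p -> (deg p <= deg g)%N ->
  exists k e, deg e = 0%N /\ p = k *: g + e.
Proof.
move=> p_in p_le; have [g0|g_gt0] := posnP (deg g).
  by exists 0, p; rewrite scale0r add0r; split => //; lia.
pose M a := exists k e, deg e = 0%N /\ a = k *: g + e.
apply: (subalg_low_ind g 1 M _ _ _ _ g_gt0 p p_in); last by rewrite mul1n.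
- by exists 0, 0; rewrite scale0r addr0 deg0.
- move=> k _ _ [k1 [e1 [e1_0 ->]]] [k2 [e2 [e2_0 ->]]].
  exists (k * k1 + k2), (k *: e1 + e2); split; first exact: deg_const_linear.
  by rewrite scalerDr addrACA scalerA scalerDl.
- by move=> i; exists 0, (one_ Phi i); rewrite scale0r add0r deg_one.
move=> w w_pure /(pure_wsize1 _ w_pure)->.
by exists 1, 0; rewrite scale1r addr0 deg0.
Qed.

Lemma subalg_quadratic g p : (0 < deg g)%N -> subalg g p ->
  (deg p <= 2 * deg g)%N ->
  exists k2 k1 e, deg e = 0%N /\ p = k2 *: (g ** g) + (k1 *: g + e).
Proof.
move=> g_gt0 p_in p_le.
pose M a := exists k2 k1 e, deg e = 0%N /\ a = k2 *: (g ** g) + (k1 *: g + e).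
apply: (subalg_low_ind g 2 M _ _ _ _ g_gt0 p p_in p_le).
- by exists 0, 0, 0; rewrite !scale0r !addr0 deg0.
- move=> k _ _ [k1 [l1 [e1 [e1_0 ->]]]] [k2 [l2 [e2 [e2_0 ->]]]].
  exists (k * k1 + k2), (k * l1 + l2), (k *: e1 + e2).
  by split; [apply: deg_const_linear|exact: lincomb2].
- by move=> i; exists 0, 0, (one_ Phi i); rewrite !scale0r !add0r deg_one.
case=> [||v w] //=.
  by move=> _ _; exists 0, 1, 0; rewrite scale0r scale1r addr0 add0r deg0.
move=> /andP[v_pure w_pure] vw_le.
have [v_gt0 w_gt0] := (wsize_gt0 v, wsize_gt0 w).
rewrite (pure_wsize1 v) 1?(pure_wsize1 w) /=; try by [|lia].
by exists 1, 0, 0; rewrite scale1r scale0r !addr0 deg0.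
Qed.

End OneVariable.

(** * Tame pairs *)

Section Tame.
Context {Phi : idomainType} {u : bool}.
Local Notation A := (free_alg Phi u).
Implicit Types (e f g h p q X Y : A) (a b c d k : Phi).

(** All of GL_2 is allowed here, not only products of elementary matrices, so
    closure under composition is a determinant computation. *)
Definition affine f1 f2 g1 g2 : Prop :=
  exists a b c d e1 e2,
    [/\ a * d - b * c \is a GRing.unit, deg e1 = 0%N, deg e2 = 0%N,
        g1 = a *: f1 + (b *: f2 + e1) & g2 = c *: f1 + (d *: f2 + e2)].

Lemma affine_upper k b d e1 e2 f1 f2 :
  k \is a GRing.unit -> d \is a GRing.unit -> deg e1 = 0%N -> deg e2 = 0%N ->
  affine f1 f2 (k *: f1 + (b *: f2 + e1)) (d *: f2 + e2).
Proof.
move=> kU dU e1_0 e2_0; exists k, b, 0, d, e1, e2; split=> //.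
  by rewrite mulr0 subr0 unitrM kU.
by rewrite scale0r add0r.
Qed.

Lemma affine_shear k b e f1 f2 : k \is a GRing.unit -> deg e = 0%N ->
  affine f1 f2 (k *: f1 + (b *: f2 + e)) f2.
Proof.
move=> kU e0; rewrite -[X in affine _ _ _ X]addr0.
rewrite -[X in affine _ _ _ (X + 0)]scale1r.
by apply: affine_upper; rewrite ?unitr1 ?deg0.
Qed.

Lemma affine_scale k f1 f2 : k \is a GRing.unit -> affine f1 f2 (k *: f1) f2.
Proof.
move=> kU; exists k, 0, 0, 1, 0, 0; split; rewrite ?deg0 //.
- by rewrite mulr1 mulr0 subr0.
- by rewrite scale0r !addr0.
- by rewrite scale0r scale1r addr0 add0r.
Qed.

Lemma affine_refl f1 f2 : affine f1 f2 f1 f2.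
Proof.
by rewrite -[X in affine _ _ X]scale1r; apply: affine_scale; apply: unitr1.
Qed.

Lemma affine_swap f1 f2 : affine f1 f2 f2 f1.
Proof.
exists 0, 1, 1, 0, 0, 0; split; rewrite ?deg0 //.
- by rewrite mul0r mul1r sub0r unitrN unitr1.
- by rewrite scale0r scale1r addr0 add0r.
- by rewrite scale0r scale1r !addr0.
Qed.

Lemma affine_trans f1 f2 g1 g2 h1 h2 :
  affine f1 f2 g1 g2 -> affine g1 g2 h1 h2 -> affine f1 f2 h1 h2.
Proof.
move=> [a' [b' [c' [d' [e1' [e2' [U' e1'_0 e2'_0 -> ->]]]]]]].
move=> [a [b [c [d [e1 [e2 [U e1_0 e2_0 -> ->]]]]]]].
rewrite !lincomb_comp.
exists (a * a' + b * c'), (a * b' + b * d').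
exists (c * a' + d * c'), (c * b' + d * d').
exists (a *: e1' + (b *: e2' + e1)), (c *: e1' + (d *: e2' + e2)).
split=> //; try by do 2?apply: deg_const_linear.
have -> : (a * a' + b * c') * (c * b' + d * d')
    - (a * b' + b * d') * (c * a' + d * c')
  = (a * d - b * c) * (a' * d' - b' * c') by ring.
by rewrite unitrM U.
Qed.

Lemma subalg_trans g h p : subalg g h -> subalg h p -> subalg g p.
Proof.
move=> h_in; elim=> [|e||a b _ IHa _ IHb|k a _ IHa|a b _ IHa _ IHb] //.
- exact: subalg_one.
- exact: subalg_zero.
- exact: subalg_add.
- exact: subalg_scale.
- exact: subalg_mul.
Qed.

(** Normal forms of tame pairs: the last nonlinear step strictly raises the
    degree, because [p] has degree greater than both [h1] and [h2]. *)
Inductive good : A -> A -> Prop :=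
| good_affine f1 f2 : affine x1 x2 f1 f2 -> good f1 f2
| good_step h1 h2 p f1 f2 :
    good h1 h2 -> (deg h1 <= deg h2)%N -> subalg h2 p -> (deg h2 < deg p)%N ->
    affine (h1 + p) h2 f1 f2 -> good f1 f2.

Lemma good_affine_closed f1 f2 g1 g2 :
  good f1 f2 -> affine f1 f2 g1 g2 -> good g1 g2.
Proof.
case=> [{}f1 {}f2 fA|h1 h2 p {}f1 {}f2 hG h_le p_in p_gt fA] gA.
  exact/good_affine/affine_trans/gA.
exact: good_step hG h_le p_in p_gt (affine_trans _ _ _ _ _ _ fA gA).
Qed.

(** If [f2] were constant then the second row of the matrix would vanish.  The
    generators enter only through their coefficients at the two letters. *)
Lemma affine_deg_gt0 X Y f1 f2 :
  X@_(inl X1) = 1 -> Y@_(inl X1) = 0 -> X@_(inl X2) = 0 -> Y@_(inl X2) = 1 ->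
  affine X Y f1 f2 -> (0 < deg f2)%N.
Proof.
move=> X_1 Y_1 X_2 Y_2 [a [b [c [d [e1 [e2 [U _ e2_0 _ f2E]]]]]]].
rewrite lt0n; apply: contraTneq U => f2_0.
have coef w : f2@_(inl w) = c * X@_(inl w) + d * Y@_(inl w).
  by rewrite f2E !mcoeffD !mcoeffZ (coef_gt_deg e2) ?addr0 // e2_0 wsize_gt0.
have vanish w : f2@_(inl w) = 0 by rewrite coef_gt_deg // f2_0 wsize_gt0.
have := coef X1; rewrite vanish X_1 Y_1 mulr1 mulr0 addr0 => <-.
have := coef X2; rewrite vanish X_2 Y_2 mulr1 mulr0 add0r => <-.
by rewrite !mulr0 subr0 unitr0.
Qed.

Lemma affine_deg_le f1 f2 g1 g2 n : affine f1 f2 g1 g2 ->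
  (deg f1 <= n)%N -> (deg f2 <= n)%N -> (deg g1 <= n)%N.
Proof.
move=> [a [b [c [d [e1 [e2 [_ e1_0 _ -> _]]]]]]] f1_le f2_le.
by apply: deg_linear => //; apply: deg_linear => //; rewrite e1_0.
Qed.

Lemma deg_x1 : (deg (x1 : A) <= 1)%N.
Proof.
by apply/degP => w w_gt; rewrite mcoeff_mon; case: w w_gt.
Qed.

Lemma deg_x2 : (deg (x2 : A) <= 1)%N.
Proof.
by apply/degP => w w_gt; rewrite mcoeff_mon; case: w w_gt.
Qed.

(** In the last step f1 = a (h1 + p) + b h2 + e1, f2 = c (h1 + p) + d h2 + e2
    the degree of [p] exceeds those of [h1] and [h2], so deg f2 < deg f1 forces
    c = 0.  The matrix is then triangular with units a and d, so [h2] and [f2]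
    generate the same subalgebra, and f1 is a h1 up to an element of it. *)
Lemma good_reduction f1 f2 : good f1 f2 -> (deg f2 < deg f1)%N ->
  exists h p, [/\ good h f2, (deg h <= deg f2)%N, subalg f2 p & f1 = h + p].
Proof.
case=> [{}f1 {}f2 fA|h1 h2 p {}f1 {}f2 hG h_le p_in p_gt fA] lt_f.
  have f1_le := affine_deg_le _ _ _ _ _ fA deg_x1 deg_x2.
  have : (0 < deg f2)%N.
    by apply: affine_deg_gt0 fA; apply: etrans (mcoeff_mon _ _) _.
  by lia.
have [a [b [c [d [e1 [e2 [U e1_0 e2_0 f1E f2E]]]]]]] := fA.
have f1_le : (deg f1 <= deg p)%N.
  by apply: (affine_deg_le _ _ _ _ _ fA); [apply: degD|]; lia.
have c0 : c = 0.
  (* otherwise the leading word of p survives in f2 *)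
  apply/eqP/contraT => c_neq0.
  have [|t tE pt] := deg_coef p; first lia.
  suff : (wsize t <= deg f2)%N by lia.
  apply: coef_neq0_deg; rewrite f2E !mcoeffD !mcoeffZ mcoeffD.
  rewrite (coef_gt_deg h1) 1?(coef_gt_deg h2) 1?(coef_gt_deg e2); try lia.
  by rewrite mulr0 add0r !addr0 mulf_neq0.
move: U f2E; rewrite {}c0 mulr0 subr0 unitrM scale0r add0r => /andP[aU dU] f2E.
have h2E : h2 = d^-1 *: (f2 - e2) by rewrite f2E addrK scalerA mulVr ?scale1r.
have h2_in : subalg f2 h2.
  rewrite h2E; apply: subalg_scale; rewrite -scaleN1r.
  apply: subalg_add; first exact: subalg_gen.
  by apply: subalg_scale; apply: subalg_const.
have h2_le : (deg h2 <= deg f2)%N by rewrite h2E degZ // degB ?e2_0.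
exists (a *: h1), (a *: p + (b *: h2 + e1)); split.
- apply: good_affine_closed hG _; rewrite f2E.
  have -> : a *: h1 = a *: h1 + (0 *: h2 + 0) by rewrite scale0r !addr0.
  by apply: affine_upper; rewrite ?deg0.
- by apply: degZ; lia.
- apply: subalg_add; first by apply/subalg_scale/(subalg_trans _ h2).
  apply: subalg_add; first exact: subalg_scale.
  exact: subalg_const.
- by rewrite f1E scalerDr -addrA.
Qed.

(** Write f1 = h + q with deg h <= deg f2 and q in the subalgebra generated by
    [f2]; either f1 is already that small, or [good_reduction] provides h.  The
    move replaces q by q + p.  If the result has degree above that of [f2], this
    is a nonlinear step from (h, f2); otherwise it is linear in [f2], and the
    step has been undone. *)
Lemma good_shear f1 f2 p : good f1 f2 -> subalg f2 p -> good (f1 + p) f2.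
Proof.
move=> fG p_in.
have [h [q [hG h_le q_in ->]]] :
  exists h q, [/\ good h f2, (deg h <= deg f2)%N, subalg f2 q & f1 = h + q].
  have [lt_f|le_f] := ltnP (deg f2) (deg f1); first exact: good_reduction.
  by exists f1, 0; rewrite addr0; split=> //; apply: subalg_zero.
rewrite -addrA; have {p_in q_in} : subalg f2 (q + p) by apply: subalg_add.
move: (q + p) => r r_in.
have [lt_r|le_r] := ltnP (deg f2) (deg r).
  exact: good_step hG h_le r_in lt_r (affine_refl _ _).
have [k [e [e0 ->]]] := subalg_linear f2 r r_in le_r.
apply: good_affine_closed hG _; rewrite -[h in h + _]scale1r.
by apply: affine_shear => //; apply: unitr1.
Qed.

(** The equivalence, and not only the direct implication, is what passes to
    inverses of tame automorphisms. *)
Lemma good_elementary k f1 f2 p : k \is a GRing.unit -> subalg f2 p ->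
  good f1 f2 <-> good (k *: f1 + p) f2.
Proof.
move=> kU p_in; split=> [fG|fG].
  apply: good_shear p_in.
  exact: good_affine_closed fG (affine_scale _ _ _ kU).
have {}fG : good (k *: f1) f2.
  rewrite -[k *: f1](addrK p) -scaleN1r.
  by apply: good_shear => //; apply: subalg_scale.
rewrite -[f1]scale1r -(mulVr kU) -scalerA.
by apply: good_affine_closed fG _; apply: affine_scale; rewrite unitrV.
Qed.

Lemma good_swap f1 f2 : good f1 f2 <-> good f2 f1.
Proof. by split=> fG; apply: good_affine_closed fG (affine_swap _ _). Qed.

Lemma good_congr f1 f2 g1 g2 : f1 = g1 -> f2 = g2 -> good f1 f2 <-> good g1 g2.
Proof. by move=> -> ->. Qed.

Lemma endo_elementary (theta : A -> A) X Y f k :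
  is_endo theta -> k \is a GRing.unit -> subalg Y f ->
  good (theta X) (theta Y) <-> good (theta (k *: X + f)) (theta Y).
Proof.
move=> thetaP kU f_in; rewrite (endoD thetaP) (endoZ thetaP).
by apply: good_elementary => //; apply: endo_subalg.
Qed.

(** Composition on the right with [phi] changes the pair of an arbitrary
    endomorphism [theta] by the moves that make up [phi]; quantifying over
    [theta] is what lets the claim compose. *)
Lemma tame_good (phi : A -> A) : tame phi ->
  is_endo phi /\ forall theta : A -> A, is_endo theta ->
    (good (theta x1) (theta x2) <-> good (theta (phi x1)) (theta (phi x2))).
Proof.
elim=> {phi} [phi [[phiP _] elem]||phi psi _ [phiP IHphi] _ [psiP IHpsi]
             |phi psi _ [phiP IHphi] phiK psiK|phi psi eq_phi _ [phiP IHphi]].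
- split=> // theta thetaP.
  have [[k [f [kU f_in phiE]]]|[k [f [kU f_in phiE]]]] := elem.
    have E1 : phi x1 = k *: x1 + f := etrans (phiE _) (endo_x1 _ _).
    have E2 : phi x2 = x2 := etrans (phiE _) (endo_x2 _ _).
    apply: iff_trans (endo_elementary theta x1 x2 f k thetaP kU f_in) _.
    by rewrite -E1 -[X in good _ (theta X) <-> _]E2.
  have E1 : phi x1 = x1 := etrans (phiE _) (endo_x1 _ _).
  have E2 : phi x2 = k *: x2 + f := etrans (phiE _) (endo_x2 _ _).
  apply: iff_trans (good_swap _ _) _.
  apply: iff_trans (endo_elementary theta x2 x1 f k thetaP kU f_in) _.
  apply: iff_trans (good_swap _ _) _.
  by rewrite -E2 -[X in good (theta X) _ <-> _]E1.
- by split=> //; apply: id_is_endo.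
- split=> [|theta thetaP]; first exact: comp_is_endo.
  apply: iff_trans (IHphi _ thetaP) _.
  exact: (IHpsi (theta \o phi) (comp_is_endo thetaP phiP)).
- have psiP := inverse_is_endo phiP phiK psiK.
  split=> // theta thetaP; apply: iff_sym.
  apply: iff_trans (IHphi (theta \o psi) (comp_is_endo thetaP psiP)) _.
  by apply: good_congr; rewrite /= phiK.
have eq_phi' : psi =1 phi by move=> a; rewrite eq_phi.
split=> [|theta thetaP]; last first.
  by apply: iff_trans (IHphi _ thetaP) _; apply: good_congr; rewrite eq_phi.
split=> [k a b|]; first by rewrite !eq_phi' (endoDZ phiP).
by split=> [a b|i]; rewrite !eq_phi' ?(endoM phiP) ?(endo_one phiP).
Qed.

(** A good pair of these degrees has f1 = c f2^2 + (terms of degree at most 2),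
    and the coefficients at (x2 x2)(x2 x2) give z = c z^2. *)
Lemma quartic_not_good (z : Phi) f1 f2 (v := Mul X2 X2) :
  z != 0 -> z \isn't a GRing.unit ->
  deg f2 = 2%N -> (deg f1 <= 4)%N ->
  f2@_(inl v) = - z -> f1@_(inl (Mul v v)) = z ->
  ~ good f1 f2.
Proof.
move=> z0 zU f2_2 f1_4 f2v f1vv fG.
have f1_ge : (4 <= deg f1)%N.
  by apply: (coef_neq0_deg f1 (Mul v v)); rewrite f1vv.
have [|h [p [_ h_le p_in f1E]]] := good_reduction f1 f2 fG; first lia.
have p_le : (deg p <= 2 * deg f2)%N.
  have -> : p = f1 - h by rewrite f1E addrC addKr.
  by apply: degB; lia.
have [|c2 [c1 [e [e0 pE]]]] := subalg_quadratic f2 p _ p_in p_le; first lia.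
move: f1vv; rewrite f1E pE !mcoeffD !mcoeffZ mcoeff_amul /=.
rewrite (coef_gt_deg h (Mul v v)) 1?(coef_gt_deg f2 (Mul v v)) /=; try lia.
rewrite (coef_gt_deg e (Mul v v)) /=; last lia.
rewrite f2v mulrNN !mulr0 mul0r !addr0 !add0r mulrA => /eqP.
rewrite -[X in _ == X]mul1r (inj_eq (mulIf z0)) => /eqP cz.
by move/negP: zU; apply; apply/unitrPr; exists c2; rewrite mulrC.
Qed.

(** Only the degrees of the generators and the coefficient 1 of [Y] at [X2]
    matter for the coefficients compared in [quartic_not_good]. *)
Lemma eta_not_good (z : Phi) X Y : z != 0 -> z \isn't a GRing.unit ->
  (deg X <= 1)%N -> (deg Y <= 1)%N -> Y@_(inl X2) = 1 ->
  let w := z *: X - Y ** Y in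
  ~ good (X + Y ** w + w ** Y + z *: (w ** w)) (Y + z *: w).
Proof.
move=> z0 zU X_le Y_le Y2 w; set v := Mul X2 X2.
have w_le : (deg w <= 2)%N.
  by apply: degB; [apply: degZ; lia|apply: leq_trans (degM _ _) _; lia].
have wv : w@_(inl v) = -1.
  rewrite mcoeffB mcoeffZ mcoeff_amul /= Y2.
  rewrite (coef_gt_deg X v) 1?(coef_gt_deg Y v) /=; try lia.
  by rewrite !mulr0 mul0r !add0r mul1r.
have f2_v : (Y + z *: w)@_(inl v) = - z.
  by rewrite mcoeffD mcoeffZ wv mulrN1 (coef_gt_deg Y v) ?add0r //=; lia.
apply: (quartic_not_good z) => //.
- apply/eqP; rewrite eqn_leq; apply/andP; split.
    by apply: degD; [lia|apply: degZ].
  by apply: (coef_neq0_deg _ v); rewrite f2_v oppr_eq0.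
- have := degM Y w; have := degM w Y; have := degM w w => *.
  by do 3?apply: degD; try apply: degZ; lia.
have mul0 (a b : A) : (deg a <= 2)%N -> (deg b <= 2)%N ->
    (a ** b)@_(inl (Mul v v)) = a@_(inl v) * b@_(inl v).
  move=> a_le b_le; rewrite mcoeff_amul /=.
  rewrite (coef_gt_deg a (Mul v v)) 1?(coef_gt_deg b (Mul v v)) /=; try lia.
  by rewrite mulr0 mul0r !add0r.
rewrite !mcoeffD mcoeffZ !mul0 //; try lia.
rewrite (coef_gt_deg X) 1?(coef_gt_deg Y) /=; try lia.
by rewrite mul0r mulr0 !add0r wv mulrNN !mulr1.
Qed.

End Tame.

Theorem theorem3 (Phi : idomainType) (PhiE : euclidean_domain Phi)
    (z : Phi) (z_neq0 : z != 0) (z_nonunit : z \isn't a GRing.unit)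
    (unital : bool) :
  let w : free_alg Phi unital := z *: x1 - x2 ** x2 in
  wild (endo (x1 + x2 ** w + w ** x2 + z *: (w ** w)) (x2 + z *: w)).
Proof.
move=> w; split.
  by have := eta_flow_auto (Phi := Phi) (u := unital) z 1; rewrite -eta_flow1.
move=> /tame_good[_ /(_ id id_is_endo)[+ _]] /=.
move=> /(_ (good_affine _ _ (affine_refl _ _))) fG.
apply: (eta_not_good z x1 x2 z_neq0 z_nonunit deg_x1 deg_x2 _).
  exact: etrans (mcoeff_mon _ _) _.
exact: (proj1 (good_congr _ _ _ _ (endo_x1 _ _) (endo_x2 _ _)) fG).
Qed.
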